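(* Let $\phi(x)\equiv f(x)+g(Ax)$ satisfy the standing assumptions (S1) and (S2) given in the context, let $\alpha>0$, and let $X$ be a solution on $\mathcal I=[0,T]\subset\mathbb{R}_+$ of the differential inclusion $$\alpha^{-1}A^TA\,\dot X(t)\in-\partial\phi(X(t)),\qquad X(0)=x_0\in\operatorname{dom}\phi .$$ If $\phi$ is convex, then for almost all $t\in\mathcal I$ $$\phi(X(t))-\phi^\star\le\frac{\sigma_1^2(A)\,\|x_0-x^\star\|^2}{2\alpha t}.$$ If $\phi$ is $\mu$-strongly convex, then for almost all $t\in\mathcal I$ $$\|X(t)-x^\star\|^2\le\kappa^2(A)\,\|x_0-x^\star\|^2\exp\!\Big(-\frac{\mu\alpha t}{\sigma_1^2(A)}\Big).$$
   Context: Here $f:\mathbb{R}^n\to\mathbb{R}\cup\{+\infty\}$, $g:\mathbb{R}^m\to\mathbb{R}\cup\{+\infty\}$, $A\in\mathbb{R}^{m\times n}$. For a function $h$ with $\operatorname{dom}h=\{x:h(x)<\infty\}$, $\partial h(x)=\{v: h(y)-h(x)\ge\langle v,y-x\rangle\ \forall y\in\operatorname{dom}h\}$ for $x\in\operatorname{dom}h$. The function $h$ is $\mu$-strongly convex ($\mu>0$) if $h(y)\ge h(x)+\langle v,y-x\rangle+(\mu/2)\|y-x\|^2$ for all $x,y\in\operatorname{dom}h$ and all $v\in\partial h(x)$; it is convex if this holds with $\mu=0$. $\phi^\star=\min_x\phi(x)$ and $x^\star$ is a minimizer of $\phi$. $\sigma_1(A)$ and $\sigma_n(A)$ are the largest and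 smallest singular values of $A$ and $\kappa(A)=\sigma_1(A)/\sigma_n(A)$. Standing assumptions. (S1) $f$ and $g$ are closed (closed epigraph) and convex, and $\phi$ has a finite global minimum; $A$ has full column rank. The paper takes this to include that $f,g$ are proper and lower semicontinuous and $0\in\operatorname{int}(\operatorname{dom}g-A\operatorname{dom}f)$, so that $\partial\phi(x)=\partial f(x)+A^T\partial g(Ax)$. (S2) There are constants $c>0$, $L>0$ such that every $\xi\in\partial\phi(x)$ satisfies $\|\xi\|\le c(1+\|x\|)$, and $\langle\xi_y-\xi_x,y-x\rangle\le L\|y-x\|^2$ for all $x,y$ and all $\xi_x\in\partial\phi(x)$, $\xi_y\in\partial\phi(y)$. A solution is an absolutely continuous function $X:\mathcal I\to\mathbb{R}^n$ satisfying the inclusion for almost all $t\in\mathcal I$. *)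

(* Defs.v *)
(* MathComp-Analysis; R is an arbitrary realType, vectors of R^n are 'cV[R]_n. *)
From HB Require Import structures.
From mathcomp Require Import all_boot all_order all_algebra.
From mathcomp Require Import all_classical all_reals all_analysis.
Import Order.TTheory GRing.Theory Num.Theory.
Import numFieldNormedType.Exports.

Set Implicit Arguments.
Unset Strict Implicit.
Unset Printing Implicit Defensive.

Local Open Scope classical_set_scope.
Local Open Scope ring_scope.

Definition dot (R : realType) (n : nat) (u v : 'cV[R]_n) : R :=
  \sum_(i < n) u i 0 * v i 0.

(* The norm `|u| that the library puts on matrices is the sup norm, so the
   Euclidean norm is defined here.  The topologies agree. *)
Definition enorm (R : realType) (n : nat) (u : 'cV[R]_n) : R :=
  Num.sqrt (dot u u).

(* A function R^n -> R u {+oo} is a function to \bar R avoiding -oo; that it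
   avoids -oo is part of [proper]. *)
Definition dom (R : realType) (n : nat) (h : 'cV[R]_n -> \bar R)
  : set 'cV[R]_n := [set x | (h x < +oo)%E].

Definition proper (R : realType) (n : nat) (h : 'cV[R]_n -> \bar R) : Prop :=
  (forall x, h x != -oo%E) /\ dom h !=set0.

Definition epigraph (R : realType) (n : nat) (h : 'cV[R]_n -> \bar R)
  : set ('cV[R]_n * R) := [set p | (h p.1 <= p.2%:E)%E].

(* Empty when x is not in dom h. *)
Definition subdiff (R : realType) (n : nat) (h : 'cV[R]_n -> \bar R)
    (x : 'cV[R]_n) : set 'cV[R]_n :=
  [set v | dom h x /\
    forall y, dom h y -> ((dot v (y - x))%:E <= h y - h x)%E].

Definition strongly_convex (R : realType) (n : nat) (mu : R)
    (h : 'cV[R]_n -> \bar R) : Prop :=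
  0 < mu /\
  forall x y v, dom h x -> dom h y -> subdiff h x v ->
    (h x + (dot v (y - x))%:E + (mu / 2 * enorm (y - x) ^+ 2)%:E <= h y)%E.

(* For mu = 0 the inequality in [strongly_convex] is the definition of the
   subdifferential and holds for every h, so convexity is stated by Jensen's
   inequality on dom h. *)
Definition convexf (R : realType) (n : nat) (h : 'cV[R]_n -> \bar R) : Prop :=
  forall (x y : 'cV[R]_n) (t : R), dom h x -> dom h y -> 0 <= t <= 1 ->
    (h (t *: x + (1 - t) *: y)%R <= t%:E * h x + (1 - t)%:E * h y)%E.

Definition minimizer (R : realType) (n : nat) (h : 'cV[R]_n -> \bar R)
    (x : 'cV[R]_n) : Prop := forall y, (h x <= h y)%E.

(* Square roots of the eigenvalues of A^T A: for A of full column rank these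
   are all n singular values of A. *)
Definition singular_values (R : realType) (m n : nat) (A : 'M[R]_(m, n))
  : set R := [set s | 0 <= s /\ eigenvalue (A^T *m A) (s ^+ 2)].

(* For n > 0 the set above is finite and nonempty: sup and inf are attained. *)
Definition sigma_max (R : realType) (m n : nat) (A : 'M[R]_(m, n)) : R :=
  sup (singular_values A).

Definition sigma_min (R : realType) (m n : nat) (A : 'M[R]_(m, n)) : R :=
  inf (singular_values A).

Definition cond_num (R : realType) (m n : nat) (A : 'M[R]_(m, n)) : R :=
  sigma_max A / sigma_min A.

Definition composite (R : realType) (m n : nat) (f : 'cV[R]_n -> \bar R)
    (g : 'cV[R]_m -> \bar R) (A : 'M[R]_(m, n)) : 'cV[R]_n -> \bar R :=
  fun x => (f x + g (A *m x)%R)%E.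

Record closed_convex (R : realType) (n : nat) (h : 'cV[R]_n -> \bar R) : Prop :=
  ClosedConvex {
    cc_proper : proper h ;
    cc_closed : closed (epigraph h) ;
    cc_lsc : lower_semicontinuous h ;
    cc_convex : convexf h }.

Record assumption_S1 (R : realType) (m n : nat) (f : 'cV[R]_n -> \bar R)
    (g : 'cV[R]_m -> \bar R) (A : 'M[R]_(m, n)) : Prop := AssumptionS1 {
  S1_f : closed_convex f ;
  S1_g : closed_convex g ;
  S1_min : exists x, composite f g A x \is a fin_num /\
                     minimizer (composite f g A) x ;
  S1_rank : \rank A = n ;
  S1_qualification :
    interior [set w | exists u x, [/\ dom g u, dom f x & w = u - A *m x]] 0 }.

Definition assumption_S2 (R : realType) (n : nat) (phi : 'cV[R]_n -> \bar R)
  : Prop :=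
  exists c L : R, [/\ 0 < c, 0 < L,
    forall x xi, subdiff phi x xi -> enorm xi <= c * (1 + enorm x) &
    forall x y xix xiy, subdiff phi x xix -> subdiff phi y xiy ->
      dot (xiy - xix) (y - x) <= L * enorm (y - x) ^+ 2].

Definition absolutely_continuous_on (R : realType) (n : nat) (a b : R)
    (X : R -> 'cV[R]_n) : Prop :=
  forall eps : R, 0 < eps -> exists2 delta : R, 0 < delta &
    forall (N : nat) (s t : 'I_N -> R),
      (forall i, [/\ a <= s i, s i <= t i & t i <= b]) ->
      trivIset [set: 'I_N] (fun i => `]s i, t i[%classic) ->
      \sum_(i < N) (t i - s i) < delta ->
      \sum_(i < N) enorm (X (t i) - X (s i)) < eps.

(* X is a total function, but only its restriction to [0, T] matters: the two
   end points, where the derivative is two-sided, form a null set. *)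
Definition solution (R : realType) (m n : nat) (A : 'M[R]_(m, n))
    (phi : 'cV[R]_n -> \bar R) (alpha T : R) (x0 : 'cV[R]_n)
    (X : R -> 'cV[R]_n) : Prop :=
  [/\ absolutely_continuous_on 0 T X,
      X 0 = x0 &
      {ae (@lebesgue_measure R), forall t, t \in `[0, T] ->
        derivable X t 1 /\
        exists2 xi, subdiff phi (X t) xi &
          alpha^-1 *: (A^T *m A *m 'D_1 X t) = - xi}].

(* Main.v *)
(* With E t = |A (X t - z)|^2 one has E' = - 2 alpha <xi, X - z> almost everywhere,
   where xi is the subgradient selected by the inclusion at time t.

   Strong convexity gives <xi, X - xstar> >= mu |X - xstar|^2 >= mu E / sigma_1^2, so
   t |-> exp (mu alpha t / sigma_1^2) E t is nonincreasing; the condition number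
   comes from sigma_n^2 |x|^2 <= |A x|^2 <= sigma_1^2 |x|^2.

   In the convex case <xi, X - xstar> >= phi (X s) - phistar >= phi (X t) - phistar for
   s <= t, because phi decreases along X, so s |-> E s + 2 alpha s (phi (X t) - phistar)
   is nonincreasing on [0, t].

   Monotonicity is obtained without integration: an absolutely continuous function
   with nonpositive left upper Dini derivative almost everywhere is nonincreasing. *)
Require Import Defs.
From HB Require Import structures.
From mathcomp Require Import all_boot all_order all_algebra.
From mathcomp Require Import all_classical all_reals all_analysis measurable_realfun.
From mathcomp Require Import ring lra.
Import Order.TTheory GRing.Theory Num.Theory.
Import numFieldNormedType.Exports.
Local Open Scope classical_set_scope.
Local Open Scope ring_scope.

(** * Euclidean inner product and norm *)

Lemma dotC {R : realType} {n : nat} (u v : 'cV[R]_n) : dot u v = dot v u.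
Proof. by apply: eq_bigr => i _; rewrite mulrC. Qed.

Lemma dotDl {R : realType} {n : nat} (u v w : 'cV[R]_n) :
  dot (u + v) w = dot u w + dot v w.
Proof. by rewrite -big_split; apply: eq_bigr => i _; rewrite mxE mulrDl. Qed.

Lemma dotZl {R : realType} {n : nat} (a : R) (u v : 'cV[R]_n) :
  dot (a *: u) v = a * dot u v.
Proof. by rewrite mulr_sumr; apply: eq_bigr => i _; rewrite mxE mulrA. Qed.

Lemma dotNl {R : realType} {n : nat} (u v : 'cV[R]_n) : dot (- u) v = - dot u v.
Proof. by rewrite -scaleN1r dotZl mulN1r. Qed.

Lemma dotBl {R : realType} {n : nat} (u v w : 'cV[R]_n) :
  dot (u - v) w = dot u w - dot v w.
Proof. by rewrite dotDl dotNl. Qed.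

Lemma dotDr {R : realType} {n : nat} (u v w : 'cV[R]_n) :
  dot w (u + v) = dot w u + dot w v.
Proof. by rewrite ![dot w _]dotC dotDl. Qed.

Lemma dotZr {R : realType} {n : nat} (a : R) (u v : 'cV[R]_n) :
  dot v (a *: u) = a * dot v u.
Proof. by rewrite ![dot v _]dotC dotZl. Qed.

Lemma dotNr {R : realType} {n : nat} (u v : 'cV[R]_n) : dot v (- u) = - dot v u.
Proof. by rewrite ![dot v _]dotC dotNl. Qed.

Lemma dotBr {R : realType} {n : nat} (u v w : 'cV[R]_n) :
  dot w (u - v) = dot w u - dot w v.
Proof. by rewrite dotDr dotNr. Qed.

Lemma dot0r {R : realType} {n : nat} (v : 'cV[R]_n) : dot v 0 = 0.
Proof. by rewrite -(scale0r v) dotZr mul0r. Qed.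

Lemma dot_trmx {R : realType} {m n : nat} (A : 'M[R]_(m, n)) u v :
  dot (A^T *m u) v = dot u (A *m v).
Proof.
rewrite /dot; under eq_bigr do rewrite mxE mulr_suml.
under [RHS]eq_bigr do rewrite mxE mulr_sumr.
rewrite exchange_big; apply: eq_bigr => i _; apply: eq_bigr => j _.
by rewrite mxE; ring.
Qed.

Lemma dot_ge0 {R : realType} {n : nat} (u : 'cV[R]_n) : 0 <= dot u u.
Proof. by apply: sumr_ge0 => i _; rewrite -expr2 sqr_ge0. Qed.

Lemma dot_eq0 {R : realType} {n : nat} (u : 'cV[R]_n) : (dot u u == 0) = (u == 0).
Proof.
apply/eqP/eqP => [h|->]; last by rewrite dot0r.
apply/matrixP => i j; rewrite (ord1 j) mxE; apply/eqP.
rewrite -sqrf_eq0 expr2.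
have /psumr_eq0P := h; move=> /(_ (fun i _ => sqr_ge0 (u i 0))) h'.
by apply/eqP/h'.
Qed.

Lemma enorm_sqr {R : realType} {n : nat} (u : 'cV[R]_n) : enorm u ^+ 2 = dot u u.
Proof. by rewrite sqr_sqrtr // dot_ge0. Qed.

Lemma enorm_ge0 {R : realType} {n : nat} (u : 'cV[R]_n) : 0 <= enorm u.
Proof. exact: sqrtr_ge0. Qed.

Lemma enormN {R : realType} {n : nat} (u : 'cV[R]_n) : enorm (- u) = enorm u.
Proof. by rewrite /enorm dotNl dotNr opprK. Qed.

(** * Positive semidefinite quadratic forms *)

(** At [a = r], [b = - q] the form equals [r * (p * r - q ^+ 2)], which settles [0 < r]. For [r = 0]
    the form with [a = 1] is affine in [b], so [q] must vanish. *)
Lemma discriminant_le {R : realType} (p q r : R) :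
  0 <= r -> (forall a b, 0 <= a ^+ 2 * p + 2 * a * b * q + b ^+ 2 * r) ->
  q ^+ 2 <= p * r.
Proof.
rewrite le_eqVlt => /orP[/eqP <- h|r0 h].
  have [->|q0] := eqVneq q 0; first by rewrite expr0n mulr0.
  have := h 1 (- (p + 1) / (2 * q)).
  rewrite (_ : _ + _ = - 1) ?oppr_ge0 ?ler10 //.
  by field.
have := h r (- q).
rewrite (_ : _ + _ = r * (p * r - q ^+ 2)); last by ring.
by rewrite pmulr_rge0 // subr_ge0.
Qed.

(** On combinations of [u] and [v] the form of [C] is a nonnegative quadratic form in two scalars;
    symmetry of [C] merges its cross terms. *)
Lemma psd_cauchy_schwarz {R : realType} {n : nat} (C : 'M[R]_n) u v :
  C^T = C -> (forall x, 0 <= dot (C *m x) x) ->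
  dot (C *m u) v ^+ 2 <= dot (C *m u) u * dot (C *m v) v.
Proof.
move=> Csym Cpos; apply: discriminant_le => // a b.
have := Cpos (a *: u + b *: v).
rewrite mulmxDr -!scalemxAr !(dotDl, dotDr, dotZl, dotZr).
have -> : dot (C *m v) u = dot (C *m u) v by rewrite -{1}Csym dot_trmx dotC.
by congr (_ <= _); ring.
Qed.

Lemma dot_le_enorm {R : realType} {n : nat} (u v : 'cV[R]_n) :
  `|dot u v| <= enorm u * enorm v.
Proof.
rewrite -ler_sqr ?nnegrE ?mulr_ge0 ?enorm_ge0 // exprMn !enorm_sqr real_normK ?num_real //.
have := @psd_cauchy_schwarz R n 1%:M u v (trmx1 _ _).
by rewrite !mul1mx; apply => x; rewrite mul1mx dot_ge0.
Qed.

Lemma enormD {R : realType} {n : nat} (u v : 'cV[R]_n) :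
  enorm (u + v) <= enorm u + enorm v.
Proof.
rewrite -ler_sqr ?nnegrE ?addr_ge0 ?enorm_ge0 // sqrrD !enorm_sqr.
rewrite !(dotDl, dotDr) [dot v u]dotC.
by have := le_trans (ler_norm _) (dot_le_enorm u v); lra.
Qed.

Lemma ler_enorm_dist {R : realType} {n : nat} (u v : 'cV[R]_n) :
  `|enorm u - enorm v| <= enorm (u - v).
Proof.
have := enormD (u - v) v; have := enormD (v - u) u.
by rewrite !subrK -(opprB u v) enormN ler_norml; lra.
Qed.

(** The Frobenius norm of [A] serves as [K], by Cauchy-Schwarz on each row. *)
Lemma mulmx_enorm_bounded {R : realType} {m n : nat} (A : 'M[R]_(m, n)) :
  exists2 K, 0 <= K & forall x, enorm (A *m x) <= K * enorm x.
Proof.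
pose r i : 'cV[R]_n := (row i A)^T.
exists (Num.sqrt (\sum_i dot (r i) (r i))) => [|x]; first exact: sqrtr_ge0.
have s0 : 0 <= \sum_i dot (r i) (r i) by apply: sumr_ge0 => i _; exact: dot_ge0.
rewrite -ler_sqr ?nnegrE ?mulr_ge0 ?enorm_ge0 ?sqrtr_ge0 //.
rewrite exprMn !enorm_sqr sqr_sqrtr // mulr_suml; apply: ler_sum => i _.
have -> : (A *m x) i 0 = dot (r i) x.
  by rewrite mxE; apply: eq_bigr => j _; rewrite !mxE.
rewrite -expr2 -real_normK ?num_real //.
rewrite -!enorm_sqr -exprMn ler_sqr ?nnegrE ?mulr_ge0 ?enorm_ge0 //.
exact: dot_le_enorm.
Qed.

(* An invertible C has enorm x bounded by enorm (C x), and Cauchy-Schwarz for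
   the form C gives |C x|^4 <= <C x, x> <C C x, C x> <= K <C x, x> |C x|^2. *)
Lemma psd_unitmx_coercive {R : realType} {n : nat} (C : 'M[R]_n) :
  C^T = C -> (forall x, 0 <= dot (C *m x) x) -> C \in unitmx ->
  exists2 c, 0 < c & forall x, c * dot x x <= dot (C *m x) x.
Proof.
move=> Csym Cpos Cu.
have [K K0 hK] := mulmx_enorm_bounded C.
have [K' K'0 hK'] := mulmx_enorm_bounded (invmx C).
have hC x : dot (C *m x) (C *m x) <= K * dot (C *m x) x.
  set y := C *m x.
  have h1 := psd_cauchy_schwarz C x y Csym Cpos.
  have h2 : dot (C *m y) y <= K * dot y y.
    apply: le_trans (le_trans (ler_norm _) (dot_le_enorm _ _)) _.
    by rewrite -enorm_sqr expr2 mulrA ler_wpM2r ?enorm_ge0.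
  have := dot_ge0 y; rewrite le_eqVlt => /orP[/eqP <-|y0].
    by rewrite mulr_ge0 ?Cpos.
  have : dot y y ^+ 2 <= dot y x * (K * dot y y).
    by apply: le_trans h1 _; rewrite ler_wpM2l ?Cpos.
  by rewrite mulrA expr2 ler_pM2r // mulrC.
have hx x : dot x x <= K' ^+ 2 * dot (C *m x) (C *m x).
  rewrite -!enorm_sqr -exprMn ler_sqr ?nnegrE ?mulr_ge0 ?enorm_ge0 //.
  by rewrite -{1}(mulKmx Cu x).
(* Adding 1 keeps the denominator positive even if [K] or [K'] vanishes. *)
have KK : 0 < K' ^+ 2 * K + 1 by rewrite ltr_wpDl // mulr_ge0 ?sqr_ge0.
exists (K' ^+ 2 * K + 1)^-1 => [|x]; first by rewrite invr_gt0.
rewrite ler_pdivrMl //; apply: le_trans (hx x) _.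
have := ler_wpM2l (sqr_ge0 K') (hC x); have := Cpos x; lra.
Qed.

(** * Extreme singular values through Rayleigh quotients *)

Lemma eigenvalue_singular {R : realType} {n : nat} (B : 'M[R]_n) (a : R) :
  B - a%:M \notin unitmx -> eigenvalue B a.
Proof. by apply: contraR => /negbNE; rewrite kermx_eq0 row_free_unit. Qed.

(** [eigenvalue] speaks of row vectors; symmetry lets a transpose turn them into columns. *)
Lemma eigenvalue_symmx {R : realType} {n : nat} (B : 'M[R]_n) (a : R) :
  B^T = B -> eigenvalue B a ->
  exists2 v : 'cV[R]_n, v != 0 & B *m v = a *: v.
Proof.
move=> Bsym /eigenvalueP[v vB v0]; exists v^T; first by rewrite trmx_eq0.
by rewrite -{1}Bsym -trmx_mul vB linearZ.
Qed.

(** For [n > 0] the supremum and infimum of these quotients are eigenvalues of [A^T *m A]; this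
    takes the place of the spectral theorem. *)
Definition rayleigh {R : realType} {m n : nat} (A : 'M[R]_(m, n)) : set R :=
  [set dot (A *m x) (A *m x) / dot x x | x in [set x : 'cV[R]_n | x != 0]].

Lemma dot_gt0 {R : realType} {n : nat} (u : 'cV[R]_n) : u != 0 -> 0 < dot u u.
Proof. by move=> u0; rewrite lt_neqAle eq_sym dot_eq0 u0 dot_ge0. Qed.

Lemma rayleigh_nonempty {R : realType} {m n : nat} (A : 'M[R]_(m, n)) :
  (0 < n)%N -> rayleigh A !=set0.
Proof.
move=> n0; exists (dot (A *m const_mx 1) (A *m const_mx 1) /
                   dot (const_mx 1 : 'cV[R]_n) (const_mx 1)).
exists (const_mx 1) => //=; apply/eqP => /matrixP /(_ (Ordinal n0) 0).
by rewrite !mxE => /eqP; rewrite oner_eq0.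
Qed.

Lemma gram_sym {R : realType} {m n : nat} (A : 'M[R]_(m, n)) :
  (A^T *m A)^T = A^T *m A.
Proof. by rewrite trmx_mul trmxK. Qed.

Lemma dot_gram {R : realType} {m n : nat} (A : 'M[R]_(m, n)) x y :
  dot (A^T *m A *m x) y = dot (A *m x) (A *m y).
Proof. by rewrite -mulmxA dot_trmx. Qed.

Lemma singular_value_rayleigh {R : realType} {m n : nat} (A : 'M[R]_(m, n)) s :
  singular_values A s -> rayleigh A (s ^+ 2).
Proof.
move=> [s0 /(eigenvalue_symmx _ _ (gram_sym A))[v v0 hv]]; exists v => //.
by rewrite -dot_gram hv dotZl mulfK // dot_eq0.
Qed.

Lemma sqrt_singular_value {R : realType} {m n : nat} (A : 'M[R]_(m, n)) (a : R) :
  0 <= a -> A^T *m A - a%:M \notin unitmx -> singular_values A (Num.sqrt a).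
Proof.
by move=> a0 ?; split; [exact: sqrtr_ge0|rewrite sqr_sqrtr// eigenvalue_singular].
Qed.

(** Let [M] be the supremum of the Rayleigh quotients. Were [M%:M - A^T *m A] invertible, it would
    be coercive with some [c > 0], and [M - c] would still bound the quotients. So [M] is an
    eigenvalue and [Num.sqrt M] a singular value. *)
Lemma sigma_max_bound {R : realType} {m n : nat} (A : 'M[R]_(m, n)) x :
  dot (A *m x) (A *m x) <= sigma_max A ^+ 2 * dot x x.
Proof.
have [n0|n0] := posnP n.
  have -> : x = 0 by subst n; exact: flatmx0.
  by rewrite mulmx0 !dot0r mulr0.
have [K K0 hK] := mulmx_enorm_bounded A.
have hubK : ubound (rayleigh A) (K ^+ 2).
  move=> _ [y /= y0 <-]; rewrite ler_pdivrMr ?dot_gt0 // -!enorm_sqr -exprMn.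
  by rewrite ler_sqr ?nnegrE ?mulr_ge0 ?enorm_ge0.
have hs : has_sup (rayleigh A).
  by split; [exact: rayleigh_nonempty|exists (K ^+ 2)].
set M := sup (rayleigh A).
have hub : ubound (rayleigh A) M by apply: ub_le_sup; case: hs.
have hM y : dot (A *m y) (A *m y) <= M * dot y y.
  have [->|y0] := eqVneq y 0; first by rewrite mulmx0 !dot0r mulr0.
  by rewrite -ler_pdivrMr ?dot_gt0 //; apply: hub; exists y.
have M0 : 0 <= M.
  have [q hq] := rayleigh_nonempty A n0.
  by apply: le_trans (hub _ hq); case: hq => y _ <-; rewrite divr_ge0 ?dot_ge0.
have hsing : A^T *m A - M%:M \notin unitmx.
  apply/negP => hu.
  have [|y||c c0 hc] := @psd_unitmx_coercive R n (M%:M - A^T *m A).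
  - by rewrite linearB /= tr_scalar_mx gram_sym.
  - by rewrite mulmxBl mul_scalar_mx dotBl dotZl dot_gram subr_ge0.
  - by rewrite -opprB -scaleN1r unitmxZ ?unitrN1.
  have : M <= M - c.
    apply: ge_sup; first exact: rayleigh_nonempty.
    move=> _ [y /= y0 <-]; rewrite ler_pdivrMr ?dot_gt0 // mulrBl.
    by have := hc y; rewrite mulmxBl mul_scalar_mx dotBl dotZl dot_gram; lra.
  by lra.
have hb : has_ubound (singular_values A).
  exists K => s hs'; rewrite -ler_sqr ?nnegrE //; last by case: hs'.
  exact/hubK/singular_value_rayleigh.
have hle : Num.sqrt M <= sigma_max A.
  by apply: ub_le_sup => //; exact: sqrt_singular_value.
apply: le_trans (hM x) _; apply: ler_wpM2r; first exact: dot_ge0.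
by rewrite -[leLHS]sqr_sqrtr // ler_sqr ?nnegrE ?(le_trans _ hle) ?sqrtr_ge0.
Qed.

(** Since <A^T A x, x> = |A x|^2, a vector killed by [A^T *m A] is killed by [A]; full column rank
    thus makes the Gram matrix invertible, hence coercive. *)
Lemma full_rank_coercive {R : realType} {m n : nat} (A : 'M[R]_(m, n)) :
  \rank A = n ->
  exists2 c, 0 < c & forall x, c * dot x x <= dot (A *m x) (A *m x).
Proof.
move=> rkA.
have [|y||c c0 hc] := @psd_unitmx_coercive R n (A^T *m A); first exact: gram_sym.
- by rewrite dot_gram dot_ge0.
- rewrite -row_free_unit -kermx_eq0; apply/eqP/row_matrixP => i.
  set r := row i _; rewrite row0.
  have hr : r *m (A^T *m A) = 0 by rewrite -row_mul mulmx_ker row0.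
  have hAr : A *m r^T = 0.
    apply/eqP; rewrite -dot_eq0 -dot_gram -{1}(gram_sym A) -trmx_mul hr trmx0.
    by rewrite dotC dot0r.
  have hAT : row_free A^T by rewrite /row_free mxrank_tr rkA.
  apply: (row_free_inj hAT); rewrite mul0mx.
  by apply: (can_inj (@trmxK _ _ _)); rewrite trmx_mul trmxK trmx0.
by exists c => // x; rewrite -dot_gram.
Qed.

(** The mirror image of [sigma_max_bound], with the infimum [M] and [A^T *m A - M%:M]; coercivity
    from full rank makes [M] positive. *)
Lemma sigma_min_bound {R : realType} {m n : nat} (A : 'M[R]_(m, n)) :
  (0 < n)%N -> \rank A = n ->
  0 < sigma_min A /\
  forall x, sigma_min A ^+ 2 * dot x x <= dot (A *m x) (A *m x).
Proof.
move=> n0 rkA; have [c c0 hc] := full_rank_coercive A rkA.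
have hlbc : lbound (rayleigh A) c.
  by move=> _ [y /= y0 <-]; rewrite ler_pdivlMr ?dot_gt0.
set M := inf (rayleigh A).
have hlb : lbound (rayleigh A) M by apply: ge_inf; exists c.
have cM : c <= M by apply: lb_le_inf => //; exact: rayleigh_nonempty.
have M0 : 0 < M by apply: lt_le_trans cM.
have hM y : M * dot y y <= dot (A *m y) (A *m y).
  have [->|y0] := eqVneq y 0; first by rewrite mulmx0 !dot0r mulr0.
  by rewrite -ler_pdivlMr ?dot_gt0 //; apply: hlb; exists y.
have hsing : A^T *m A - M%:M \notin unitmx.
  apply/negP => hu.
  have [|y||d d0 hd] := @psd_unitmx_coercive R n (A^T *m A - M%:M).
  - by rewrite linearB /= tr_scalar_mx gram_sym.
  - by rewrite mulmxBl mul_scalar_mx dotBl dotZl dot_gram subr_ge0.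
  - by [].
  have : M + d <= M.
    apply: lb_le_inf; first exact: rayleigh_nonempty.
    move=> _ [y /= y0 <-]; rewrite ler_pdivlMr ?dot_gt0 // mulrDl.
    by have := hd y; rewrite mulmxBl mul_scalar_mx dotBl dotZl dot_gram; lra.
  by lra.
have hS : singular_values A (Num.sqrt M) by apply: sqrt_singular_value => //; exact: ltW.
(* [h1] yields the positivity of [sigma_min A], [h2] the quadratic bound. *)
have h1 : Num.sqrt M <= sigma_min A.
  apply: lb_le_inf; first by exists (Num.sqrt M).
  move=> s hs; rewrite -ler_sqr ?nnegrE ?sqrtr_ge0 //; last by case: hs.
  by rewrite sqr_sqrtr ?(ltW M0) //; exact/hlb/singular_value_rayleigh.
have h2 : sigma_min A <= Num.sqrt M.
  by apply: ge_inf => //; exists 0 => s [].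
have s0 : 0 < sigma_min A by apply: lt_le_trans h1; rewrite sqrtr_gt0.
split=> // x; apply: le_trans (hM x); apply: ler_wpM2r; first exact: dot_ge0.
by rewrite -[leRHS](sqr_sqrtr (ltW M0)) ler_sqr ?nnegrE ?sqrtr_ge0 ?(ltW s0).
Qed.

(** * Monotonicity from an almost everywhere derivative bound *)

(** One-sided absolute continuity: the sums of signed increments are bounded above only, so falls of
    [h] are unrestricted. *)
Definition upper_ac {R : realType} (a b : R) (h : R -> R) : Prop :=
  forall eps : R, 0 < eps -> exists2 delta : R, 0 < delta &
    forall (N : nat) (s t : 'I_N -> R),
      (forall i, [/\ a <= s i, s i <= t i & t i <= b]) ->
      trivIset [set: 'I_N] (fun i => `]s i, t i[%classic) ->
      \sum_(i < N) (t i - s i) < delta ->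
      \sum_(i < N) (h (t i) - h (s i)) < eps.

Definition increments {R : realType} (h : R -> R) (U : set R) (a x : R) : set R :=
  [set v | exists N (s t : 'I_N -> R),
    [/\ (forall i, [/\ a <= s i, s i <= t i & t i <= x]),
        (forall i, `]s i, t i[%classic `<=` U),
        trivIset [set: 'I_N] (fun i => `]s i, t i[%classic) &
        v = \sum_(i < N) (h (t i) - h (s i))]].

(** Converts a small measure of [U] into the small total length that [upper_ac] asks for. *)
Lemma sum_itv_le_measure {R : realType} (U : set R) (N : nat) (s t : 'I_N -> R) :
  open U -> (forall i, s i <= t i) -> (forall i, `]s i, t i[%classic `<=` U) ->
  trivIset [set: 'I_N] (fun i => `]s i, t i[%classic) ->
  ((\sum_(i < N) (t i - s i))%:E <= @lebesgue_measure R U)%E.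
Proof.
move=> oU st stU tI.
have -> : (\sum_(i < N) (t i - s i))%:E =
          (\sum_(i < N) @lebesgue_measure R `]s i, t i[%classic)%E.
  rewrite -sumEFin; apply: eq_bigr => i _; rewrite lebesgue_measure_itv /= lte_fin.
  have := st i; rewrite le_eqVlt => /orP[/eqP ->|->//].
  by rewrite ltxx subrr.
rewrite -measure_bigsetU_ord //; apply: le_measure; rewrite ?inE.
- by apply: bigsetU_measurable.
- exact: open_measurable.
- by elim/big_ind: _ => [x []|B C BU CU|i _]; rewrite ?subUset //; exact: stU.
Qed.

Lemma increments0 {R : realType} (h : R -> R) (U : set R) (a x : R) :
  increments h U a x 0.
Proof.
exists 0%N, (fun _ => 0), (fun _ => 0); split; [by case|by case| |by rewrite big_ord0].
by move=> [].
Qed.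

Lemma increments_subset {R : realType} (h : R -> R) (U : set R) (a x y : R) :
  x <= y -> increments h U a x `<=` increments h U a y.
Proof.
move=> xy v [N [s [t [h1 h2 h3 h4]]]]; exists N, s, t; split=> // i.
by have [? ? tx] := h1 i; split=> //; exact: le_trans xy.
Qed.

Lemma increments_step {R : realType} (h : R -> R) (U : set R) (a x y v : R) :
  a <= x -> x <= y -> `]x, y[%classic `<=` U -> increments h U a x v ->
  increments h U a y (v + (h y - h x)).
Proof.
move=> ax xy xyU [N [s [t [h1 h2 h3 h4]]]].
(* The new interval takes index 0; it is disjoint from the others because they all end by [x]. *)
pose s' (i : 'I_N.+1) := if unlift ord0 i is Some j then s j else x.
pose t' (i : 'I_N.+1) := if unlift ord0 i is Some j then t j else y.
have disj i z : `]s i, t i[%classic z -> `]x, y[%classic z -> False.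
  rewrite /= !in_itv /= => /andP[_ zt] /andP[xz _].
  by have [_ _ tx] := h1 i; have := lt_trans zt (le_lt_trans tx xz); rewrite ltxx.
exists N.+1, s', t'; split.
- move=> i; rewrite /s' /t'; case: unliftP => [j|] _ //.
  by have [? ? tx] := h1 j; split=> //; exact: le_trans xy.
- by move=> i; rewrite /s' /t'; case: unliftP.
- move=> i j _ _; rewrite /s' /t'.
  case: unliftP => [i'|] ->; case: unliftP => [j'|] -> //= [z [z1 z2]].
  + by rewrite (h3 i' j') //; exists z.
  + by have := disj _ _ z1 z2.
  + by have := disj _ _ z2 z1.
- rewrite big_ord_recl /s' /t' unlift_none addrC h4; congr (_ + _).
  by apply: eq_bigr => i _; rewrite liftK.
Qed.

(** Left difference quotients of [p] at [s] are eventually at most [d + eps <= eps]. *)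
Lemma is_derive_left_bound {R : realType} (p : R -> R) (s d eps : R) :
  is_derive s 1 p d -> d <= 0 -> 0 < eps ->
  exists2 r, 0 < r & forall t, t <= s -> s - t < r -> p s - p t <= eps * (s - t).
Proof.
move=> [dp dd] d0 eps0; rewrite -dd in d0.
move/cvgrPdist_le: dp => /(_ _ eps0)[r /= r0 hr]; exists r => // t.
rewrite le_eqVlt => /orP[/eqP ->|ts] str; first by rewrite !subrr mulr0.
have ts0 : t - s != 0 by rewrite subr_eq0 lt_eqF.
have := hr (t - s); rewrite /ball_ /= sub0r normrN ltr0_norm ?subr_lt0 // opprB.
move=> /(_ str ts0); rewrite /= [_%:A]mulr1 subrK.
rewrite -[lim _]/('D_1 p s) ler_norml => /andP[h1 _].
have st0 : 0 < s - t by rewrite subr_gt0.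
have : (t - s)^-1 *: (p t - p s) <= eps + 'D_1 p s by lra.
rewrite -[_ *: _]/(_ * _) -[t - s]opprB invrN -[p t - p s]opprB mulrNN.
rewrite ler_pdivrMl // => h2; apply: le_trans h2 _.
by rewrite mulrC (ler_wpM2r (ltW st0)) //; lra.
Qed.

Lemma upper_ac_right {R : realType} (a b : R) (h : R -> R) (eps : R) :
  upper_ac a b h -> 0 < eps -> exists2 r, 0 < r &
  forall s t, a <= s -> s <= t -> t <= b -> t - s < r -> h t - h s < eps.
Proof.
move=> hac eps0; have [r r0 hr] := hac _ eps0; exists r => // s t as_ st tb str.
have := hr 1%N (fun _ => s) (fun _ => t); rewrite !big_ord1; apply => //.
by move=> i j _ _ _; rewrite !ord1.
Qed.

(* Otherwise the infimum of the points where k reaches k b would be a limit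
   from the right of such points, where k is below k b. *)
Lemma le_of_locally_decreasing {R : realType} (k : R -> R) (a b : R) :
  a <= b ->
  (forall s, a < s -> s <= b -> exists2 r, 0 < r &
     forall t, a <= t -> t <= s -> s - t < r -> k s <= k t) ->
  (forall s eps, a <= s -> s <= b -> 0 < eps -> exists2 r, 0 < r &
     forall t, s <= t -> t <= b -> t - s < r -> k t - k s < eps) ->
  k b <= k a.
Proof.
move=> ab hl hr; rewrite leNgt; apply/negP => kab.
pose Z := [set s | [/\ a <= s, s <= b & k b <= k s]].
have Zb : Z b by split.
have Zlb : has_lbound Z by exists a => s [].
have Zi : has_inf Z by split; [exists b|].
set s := inf Z.
have as_ : a <= s by apply: lb_le_inf => [|t []//]; exists b.
have sb : s <= b by apply: ge_inf.
(* If [k] reaches [k b] at the infimum [s] itself, then [a < s], and the left hypothesis gives a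
   point of [Z] below [s]. *)
have [kbs|ksb] := leP (k b) (k s).
  have as' : a < s.
    by rewrite lt_neqAle as_ andbT; apply/eqP => e; move: kbs; rewrite -e leNgt kab.
  have [r r0 hs] := hl _ as' sb.
  have [t /andP[t1 t2]] : exists t, Num.max a (s - r) < t < s.
    have mx : Num.max a (s - r) < s by rewrite gt_max as' ltrBlDr ltrDl.
    by exists ((Num.max a (s - r) + s) / 2); rewrite !midf_lt.
  move: t1; rewrite gt_max => /andP[at_ srt].
  have : Z t.
    split; [exact: ltW|exact: le_trans (ltW t2) sb|].
    by apply: le_trans kbs (hs _ _ _ _); rewrite ?ltW //; lra.
  by move=> /(ge_inf Zlb); rewrite leNgt t2.
have ksb' : 0 < k b - k s by rewrite subr_gt0.
have [r r0 hs] := hr s _ as_ sb ksb'.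
have [t Zt ts] := inf_adherent r0 Zi.
have [at_ tb kt] := Zt.
have st : s <= t by apply: ge_inf.
have := hs t st tb; rewrite -/s in ts; rewrite ltrBlDl => /(_ ts); lra.
Qed.

(* With U an open neighbourhood of small measure of the exceptional set, and W x
   the supremum of the increments of h over disjoint intervals in U left of x,
   the function h - W - e id satisfies the previous lemma. *)
Lemma upper_ac_decreasing {R : realType} (h : R -> R) (a b : R) :
  a <= b -> upper_ac a b h ->
  {ae @lebesgue_measure R, forall s, s \in `[a, b] ->
    exists (p : R -> R) (d : R), [/\ is_derive s 1 p d, d <= 0 &
      forall t, a <= t -> t <= s -> h s - h t <= p s - p t]} ->
  h b <= h a.
Proof.
move=> ab hac [N [mN muN hN]].
have N0 : @lebesgue_measure R N = 0%E by [].
(* The slope [e] of the correction costs [e * (b - a)]; the last [e] pays for the later bound on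
   [W b]. *)
suff H e : 0 < e -> h b <= h a + e * (b - a) + e.
  apply/ler_addgt0Pr => e e0.
  have c0 : 0 < b - a + 1 by lra.
  have := H (e / (b - a + 1)); rewrite divr_gt0 // => /(_ isT) /le_trans; apply.
  by rewrite -addrA -{2}(mulr1 (e / _)) -mulrDr divfK ?gt_eqF.
move=> e0; have [delta d0 hd] := hac _ e0.
have Noo : (@lebesgue_measure R N < +oo)%E by rewrite N0.
have [U [oU NU muU]] := @lebesgue_regularity_outer R N delta mN Noo d0.
(* Outer regularity bounds only the part of [U] outside [N]; the null set [N] adds nothing. *)
have Ud : (@lebesgue_measure R U < delta%:E)%E.
  have mUN : measurable (U `\` N).
    by apply: measurableD => //; exact: open_measurable.
  have := measureU2 (@lebesgue_measure R) mUN mN.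
  rewrite setDKU // => /le_lt_trans; apply.
  by move: muU; rewrite -[X in (X < _)%E]adde0 -N0.
have Sle x v : x <= b -> increments h U a x v -> v <= e.
  move=> xb /(increments_subset _ _ _ _ _ xb)[M [s [t [h1 h2 h3 ->]]]].
  apply/ltW/hd => //; rewrite -lte_fin; apply: le_lt_trans Ud.
  by apply: sum_itv_le_measure => // i; have [] := h1 i.
pose W x := sup (increments h U a x).
have Ssup x : x <= b -> has_sup (increments h U a x).
  by move=> xb; split; [exists 0; exact: increments0|exists e => v; exact: Sle].
have Wmono x y : x <= y -> y <= b -> W x <= W y.
  move=> xy yb; apply: ge_sup; first by exists 0; exact: increments0.
  move=> v /(increments_subset _ _ _ _ _ xy).
  by apply: ub_le_sup; case: (Ssup y yb).
have Wstep x y : a <= x -> x <= y -> y <= b -> `]x, y[%classic `<=` U ->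
    h y - h x <= W y - W x.
  move=> ax xy yb xyU; rewrite lerBrDl -lerBrDr.
  apply: ge_sup; first by exists 0; exact: increments0.
  move=> v hv; rewrite lerBrDr; apply: ub_le_sup; first by case: (Ssup y yb).
  exact: increments_step.
have Wa : 0 <= W a.
  by apply: ub_le_sup; [case: (Ssup a ab)|exact: increments0].
have Wb : W b <= e.
  by apply: ge_sup; [exists 0; exact: increments0|move=> v; exact: Sle].
pose k x := h x - W x - e * x.
suff : k b <= k a by rewrite /k; lra.
apply: le_of_locally_decreasing => // [s as_ sb|s eps as_ sb eps0]; last first.
  (* To the right, subtracting the nondecreasing [W] and [e * x] creates no rise, so the bound for
     [h] suffices. *)
  have [r r0 hr] := upper_ac_right _ _ _ _ hac eps0; exists r => // t st tb str.
  have := hr s t as_ st tb str; have := Wmono _ _ st tb; rewrite /k.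
  have := ler_wpM2l (ltW e0) st; lra.
(* Inside [U] the growth of [W] pays for that of [h]. Outside, [s] is not exceptional, and the
   comparison function [p] leaves only the slope [e]. *)
have [Us|nUs] := pselect (U s).
  have /nbhs_ballP[r /= r0 hr] : nbhs s U by exact: open_nbhs_nbhs.
  exists r => // t at_ ts str.
  have : h s - h t <= W s - W t.
    apply: Wstep => // z; rewrite /= in_itv /= => /andP[tz zs].
    by apply: hr; rewrite /ball /= ltr_norml; lra.
  by have := ler_wpM2l (ltW e0) ts; rewrite /k; lra.
have hs : s \in `[a, b] by rewrite in_itv /= (ltW as_).
have [p [d [hp d_0 hpt]]] : exists (p : R -> R) (d : R), [/\ is_derive s 1 p d,
    d <= 0 & forall t, a <= t -> t <= s -> h s - h t <= p s - p t].
  by apply: contrapT => nH; apply/nUs/NU/hN => /(_ hs).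
have [r r0 hr] := is_derive_left_bound _ _ _ _ hp d_0 e0; exists r => // t at_ ts str.
have := hr t ts str; have := hpt t at_ ts; have := Wmono t s ts sb.
by rewrite /k; lra.
Qed.

(** * Absolutely continuous curves and their derivatives *)

Lemma absolutely_continuous_on_sub {R : realType} {n : nat} (a b a' b' : R)
    (X : R -> 'cV[R]_n) :
  a <= a' -> b' <= b ->
  absolutely_continuous_on a b X -> absolutely_continuous_on a' b' X.
Proof.
move=> aa bb hX eps /hX[d d0 hd]; exists d => // N s t hst; apply: hd => i.
by have [? ? ?] := hst i; split=> //; [exact: le_trans aa _|exact: le_trans bb].
Qed.

(** Total time and total displacement over the intervals each stay below [eps / (C + 1) / 2], where
    [C + 1] avoids a division by zero. Every auxiliary function along the flow becomes [upper_ac]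
    through this bound. *)
Lemma upper_ac_dominated {R : realType} {n : nat} (a b C : R)
    (X : R -> 'cV[R]_n) (h : R -> R) :
  0 <= C -> absolutely_continuous_on a b X ->
  (forall s t, a <= s -> s <= t -> t <= b ->
    h t - h s <= C * (t - s + enorm (X t - X s))) ->
  upper_ac a b h.
Proof.
move=> C0 hX hh eps eps0.
have C1 : 0 < C + 1 by lra.
have e0 : 0 < eps / (C + 1) / 2 by rewrite !divr_gt0.
have [d d0 hd] := hX _ e0.
exists (Num.min d (eps / (C + 1) / 2)) => [|N s t hst tI].
  by rewrite lt_min d0.
rewrite lt_min => /andP[sd se].
have Xe := hd N s t hst tI sd.
have : \sum_(i < N) (h (t i) - h (s i)) <=
    C * (\sum_(i < N) (t i - s i) + \sum_(i < N) enorm (X (t i) - X (s i))).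
  rewrite -big_split mulr_sumr; apply: ler_sum => i _.
  by have [? ? ?] := hst i; exact: hh.
have : 0 <= \sum_(i < N) (t i - s i) + \sum_(i < N) enorm (X (t i) - X (s i)).
  rewrite addr_ge0 ?sumr_ge0 // => i _; rewrite ?enorm_ge0 //.
  by have [_ ? _] := hst i; rewrite subr_ge0.
move: Xe se; set u := \sum_(i < N) _; set v := \sum_(i < N) _ => Xe se uv0 hle.
have : (C + 1) * (v + u) < (C + 1) * (eps / (C + 1)) by rewrite ltr_pM2l //; lra.
by rewrite [X in _ < X]mulrC divfK ?gt_eqF //; lra.
Qed.

(** The norm of [X] is continuous on a compact interval, so it attains its maximum. The bound gives
    uniform constants for subgradients and energies along the curve. *)
Lemma absolutely_continuous_bounded {R : realType} {n : nat} (a b : R)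
    (X : R -> 'cV[R]_n) :
  a <= b -> absolutely_continuous_on a b X ->
  exists2 rho, 0 <= rho & forall t, a <= t -> t <= b -> enorm (X t) <= rho.
Proof.
move=> ab hX.
have hc : {within `[a, b], continuous (fun t => enorm (X t))}.
  apply/subspace_continuousP => x; rewrite /= in_itv /= => /andP[ax xb].
  apply/cvgrPdist_lt => eps eps0; have [d d0 hd] := hX _ eps0.
  have hst s t : a <= s -> s <= t -> t <= b -> t - s < d -> enorm (X t - X s) < eps.
    move=> as_ st tb std; have := hd 1%N (fun _ => s) (fun _ => t).
    by rewrite !big_ord1; apply => // i j _ _ _; rewrite !ord1.
  rewrite near_withinE; near=> t; rewrite /= in_itv /= => /andP[at_ tb].
  apply: le_lt_trans (ler_enorm_dist _ _) _.
  have : `|x - t| < d by near: t; apply: nbhsx_ballx.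
  rewrite ltr_norml => /andP[h1 h2].
  have [xt|tx] := leP x t; last by apply: hst => //; exact: ltW.
  by rewrite -(opprB (X t)) enormN; apply: hst => //; lra.
have [c _ hmax] := EVT_max ab hc.
exists (enorm (X c)) => [|t at_ tb]; first exact: enorm_ge0.
by apply: hmax; rewrite in_itv /= at_.
Unshelve. all: by end_near. Qed.

(** Working by coordinates gives access to the calculus rules for real functions. *)
Definition coord_derive {R : realType} {n : nat} (X : R -> 'cV[R]_n) (t : R)
    (D : 'cV[R]_n) : Prop :=
  forall i, is_derive t 1 (fun s => X s i 0) (D i 0).

Lemma derivable_coord_derive {R : realType} {n : nat} (X : R -> 'cV[R]_n) (t : R) :
  derivable X t 1 -> coord_derive X t ('D_1 X t).
Proof.
move=> dX i; rewrite derive_mx // mxE; apply: derivableP.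
by move/derivable_mxP: dX; apply.
Qed.

Lemma coord_derive_cst {R : realType} {n : nat} (v : 'cV[R]_n) (t : R) :
  coord_derive (fun _ => v) t 0.
Proof. by move=> i; rewrite mxE; exact: is_derive_cst. Qed.

Lemma coord_derive_subr {R : realType} {n : nat} (X : R -> 'cV[R]_n) (t : R) D v :
  coord_derive X t D -> coord_derive (fun s => X s - v) t D.
Proof.
move=> hX i; under eq_fun do rewrite !mxE.
by have := is_deriveB (hX i) (is_derive_cst (v i 0) t 1); rewrite subr0.
Qed.

Lemma is_derive_dot {R : realType} {n : nat} (X Y : R -> 'cV[R]_n) (t : R) DX DY :
  coord_derive X t DX -> coord_derive Y t DY ->
  is_derive t 1 (fun s => dot (X s) (Y s)) (dot DX (Y t) + dot (X t) DY).
Proof.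
move=> hX hY.
have h i := is_deriveM (hX i) (hY i).
have := is_derive_sum h.
rewrite (_ : \sum_i _ = fun s => dot (X s) (Y s)); last first.
  by apply/funext => s; rewrite fct_sumE.
move=> /is_derive_eq; apply; rewrite big_split addrC; congr (_ + _).
by apply: eq_bigr => i _; rewrite /= mulrC.
Qed.

Lemma coord_derive_mulmx {R : realType} {m n : nat} (A : 'M[R]_(m, n)) X (t : R) D :
  coord_derive X t D -> coord_derive (fun s => A *m X s) t (A *m D).
Proof.
move=> hX i.
have hd (v : 'cV[R]_n) : (A *m v) i 0 = dot (row i A)^T v.
  by rewrite mxE; apply: eq_bigr => j _; rewrite !mxE.
under eq_fun do rewrite hd.
have := is_derive_dot _ _ _ _ _ (coord_derive_cst (row i A)^T t) hX.
by move=> /is_derive_eq; apply; rewrite hd dotC dot0r add0r.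
Qed.

(** * Subgradients and finite minorants *)

(** [Phi] is the supremum of the supporting affine functions x |-> p z + <xi, x - z>. Slopes bounded
    by [C] make it Lipschitz; the second hypothesis keeps these functions below [p] at every contact
    point, so [Phi] agrees with [p] there. *)
Lemma lipschitz_minorant {R : realType} {n : nat} (p : 'cV[R]_n -> R)
    (S : 'cV[R]_n -> 'cV[R]_n -> Prop) (C : R) :
  (forall z xi, S z xi -> enorm xi <= C) ->
  (forall z xi w eta, S z xi -> S w eta -> dot xi (w - z) <= p w - p z) ->
  (exists z xi, S z xi) ->
  exists Phi : 'cV[R]_n -> R,
    [/\ forall z xi, S z xi -> Phi z = p z,
        forall z xi y, S z xi -> dot xi (y - z) <= Phi y - Phi z &
        forall x y, Phi x - Phi y <= C * enorm (x - y)].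
Proof.
move=> SC Sp [z0 [xi0 S0]].
pose V x := [set v | exists z xi, S z xi /\ v = p z + dot xi (x - z)].
have Sdist z xi x y : S z xi -> dot xi (x - y) <= C * enorm (x - y).
  move=> /SC h; apply: le_trans (le_trans (ler_norm _) (dot_le_enorm _ _)) _.
  by rewrite ler_wpM2r ?enorm_ge0.
have dotB_split x z w (v : 'cV[R]_n) : dot v (x - z) = dot v (x - w) + dot v (w - z).
  by rewrite -dotDr addrA subrK.
have V0 x : V x !=set0 by exists (p z0 + dot xi0 (x - z0)), z0, xi0.
have Vub x : has_ubound (V x).
  (* A support from [z] is at most [p z0] at the fixed contact point [z0], and from there it grows
     at rate at most [C]. *)
  exists (p z0 + C * enorm (x - z0)) => _ [z [xi [Sz ->]]].
  have := Sp _ _ _ _ Sz S0; have := Sdist _ _ x z0 Sz.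
  by rewrite (dotB_split x z z0); lra.
have PhiP z xi : S z xi -> sup (V z) = p z.
  move=> Sz; apply/eqP; rewrite eq_le; apply/andP; split.
    apply: ge_sup => // _ [w [eta [Sw ->]]].
    by have := Sp _ _ _ _ Sw Sz; lra.
  by apply: ub_le_sup => //; exists z, xi; rewrite subrr dot0r addr0.
exists (fun x => sup (V x)); split=> [//|z xi y Sz|x y].
  rewrite (PhiP _ _ Sz) lerBrDl; apply: ub_le_sup => //.
  by exists z, xi.
rewrite lerBlDr; apply: ge_sup => // _ [z [xi [Sz ->]]].
have : p z + dot xi (y - z) <= sup (V y) by apply: ub_le_sup => //; exists z, xi.
have := Sdist _ _ x y Sz.
by rewrite (dotB_split x z y); lra.
Qed.

Lemma subdiff_fine {R : realType} {n : nat} (h : 'cV[R]_n -> \bar R) x y xi :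
  (forall z, h z != -oo%E) -> subdiff h x xi -> dom h y ->
  dot xi (y - x) <= fine (h y) - fine (h x).
Proof.
move=> hN [hx hxi] hy; have := hxi y hy; move: hx hy (hN x) (hN y).
by rewrite /dom /=; case: (h x) (h y) => [a| |] [b| |].
Qed.

Lemma strongly_convex_fine {R : realType} {n : nat} (mu : R)
    (h : 'cV[R]_n -> \bar R) x y xi :
  (forall z, h z != -oo%E) -> strongly_convex mu h ->
  subdiff h x xi -> dom h y ->
  fine (h x) + dot xi (y - x) + mu / 2 * enorm (y - x) ^+ 2 <= fine (h y).
Proof.
move=> hN [_ hsc] hxi hy; have hx := hxi.1; have := hsc x y xi hx hy hxi.
move: hx hy (hN x) (hN y).
by rewrite /dom /=; case: (h x) (h y) => [a| |] [b| |].
Qed.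

Lemma minimizer_subdiff {R : realType} {n : nat} (h : 'cV[R]_n -> \bar R) x :
  h x \is a fin_num -> minimizer h x -> subdiff h x 0.
Proof.
move=> hx hmin; split; first by rewrite /dom /= ltey_eq hx.
by move=> y _; rewrite dotC dot0r sube_ge0 ?hx //; exact: hmin.
Qed.

(* The library's instance is found only when the Lebesgue measure is given on the
   Borel measurable type; here it is on the semiring of half-open intervals. *)
#[local] Instance lebesgue_ae_filter {R : realType} :
  Filter (nbhs (almost_everywhere (@lebesgue_measure R))).
Proof. exact: (ae_filter_ringOfSetsType (@lebesgue_measure R)). Qed.

(** * Energy and value along solutions *)

(** Differentiating |A (X - z)|^2 produces exactly the term [A^T *m A *m 'D_1 X s] of the inclusion,
    which the flow trades for the subgradient. *)
Lemma energy_derive {R : realType} {m n : nat} (A : 'M[R]_(m, n)) (alpha : R)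
    (X : R -> 'cV[R]_n) (z xi : 'cV[R]_n) (s : R) :
  0 < alpha -> derivable X s 1 -> alpha^-1 *: (A^T *m A *m 'D_1 X s) = - xi ->
  is_derive s 1 (fun t => dot (A *m (X t - z)) (A *m (X t - z)))
    (- (2 * alpha * dot xi (X s - z))).
Proof.
move=> a0 /derivable_coord_derive/coord_derive_subr => /(_ z) hX hxi.
have hAX := coord_derive_mulmx A _ _ _ hX.
have := is_derive_dot _ _ _ _ _ hAX hAX.
move=> /is_derive_eq; apply.
have -> : xi = - (alpha^-1 *: (A^T *m A *m 'D_1 X s)) by rewrite hxi opprK.
rewrite dotNl dotZl dot_gram [dot (A *m (X s - z)) _]dotC.
by field; rewrite gt_eqF.
Qed.

(** In |u|^2 - |v|^2 = <u - v, u + v> the second factor is bounded on a bounded trajectory. *)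
Lemma energy_lipschitz {R : realType} {m n : nat} (A : 'M[R]_(m, n)) (T rho : R)
    (X : R -> 'cV[R]_n) (z : 'cV[R]_n) :
  0 <= rho -> (forall t, 0 <= t -> t <= T -> enorm (X t) <= rho) ->
  exists2 C, 0 <= C & forall s t, 0 <= s <= T -> 0 <= t <= T ->
    dot (A *m (X t - z)) (A *m (X t - z)) - dot (A *m (X s - z)) (A *m (X s - z))
      <= C * enorm (X t - X s).
Proof.
move=> rho0 hrho; have [K K0 hK] := mulmx_enorm_bounded A.
exists (K * (K * (2 * (rho + enorm z)))).
  by rewrite !mulr_ge0 ?addr_ge0 ?enorm_ge0.
move=> s t /andP[s0 sT] /andP[t0 tT].
set u := A *m (X t - z); set v := A *m (X s - z).
have uv : u - v = A *m (X t - X s) by rewrite -mulmxBr opprB addrA subrK.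
have bound r : 0 <= r -> r <= T -> enorm (A *m (X r - z)) <= K * (rho + enorm z).
  move=> r0 rT; apply: le_trans (hK _) _; apply: ler_wpM2l => //.
  by apply: le_trans (enormD _ _) _; rewrite enormN lerD2r hrho.
have -> : dot u u - dot v v = dot (u - v) (u + v).
  by rewrite dotBl !dotDr [dot v u]dotC; ring.
apply: le_trans (le_trans (ler_norm _) (dot_le_enorm _ _)) _.
rewrite [leRHS](_ : _ = (K * enorm (X t - X s)) * (K * (2 * (rho + enorm z)))).
  apply: ler_pM; rewrite ?enorm_ge0 ?uv //.
  apply: le_trans (enormD _ _) _.
  by have := bound _ t0 tT; have := bound _ s0 sT; rewrite -/u -/v; lra.
by ring.
Qed.

(** Needed when an exponential weight multiplies the energy: the variation of the weight is scaled
    by this bound. *)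
Lemma energy_bounded {R : realType} {m n : nat} (A : 'M[R]_(m, n)) (T rho : R)
    (X : R -> 'cV[R]_n) (z : 'cV[R]_n) :
  0 <= rho -> (forall t, 0 <= t -> t <= T -> enorm (X t) <= rho) ->
  exists2 B, 0 <= B & forall t, 0 <= t <= T ->
    dot (A *m (X t - z)) (A *m (X t - z)) <= B.
Proof.
move=> rho0 hrho; have [K K0 hK] := mulmx_enorm_bounded A.
exists ((K * (rho + enorm z)) ^+ 2) => [|t /andP[t0 tT]]; first exact: sqr_ge0.
rewrite -enorm_sqr ler_sqr ?nnegrE ?enorm_ge0 ?mulr_ge0 ?addr_ge0 ?enorm_ge0 //.
apply: le_trans (hK _) _; apply: ler_wpM2l => //.
by apply: le_trans (enormD _ _) _; rewrite enormN lerD2r hrho.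
Qed.

(* [phi \o X] need only make sense where the inclusion holds, so phi is replaced
   by a finite Lipschitz minorant with the same subgradients along X. *)
Lemma solution_value_decreasing {R : realType} {m n : nat} (A : 'M[R]_(m, n))
    (phi : 'cV[R]_n -> \bar R) (alpha T : R) (x0 : 'cV[R]_n) (X : R -> 'cV[R]_n)
    (s t : R) (xis xit : 'cV[R]_n) :
  (forall z, phi z != -oo%E) -> assumption_S2 phi -> 0 < alpha ->
  solution A phi alpha T x0 X ->
  0 <= s -> s <= t -> t <= T ->
  subdiff phi (X s) xis -> subdiff phi (X t) xit ->
  fine (phi (X t)) <= fine (phi (X s)).
Proof.
move=> phiN [c [L [c0 _ hc _]]] a0 [hac _ hae] s0 st tT hs ht.
have [rho rho0 hrho] := absolutely_continuous_bounded _ _ _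
  (le_trans s0 (le_trans st tT)) hac.
(* Restriction to the ball of radius [rho] turns the linear growth of subgradients into one
   Lipschitz constant [c * (1 + rho)]. *)
pose S z xi := enorm z <= rho /\ subdiff phi z xi.
have [||| Phi [PhiE Phisub PhiL]] :=
    lipschitz_minorant (fun x => fine (phi x)) S (c * (1 + rho)).
- move=> z xi [zr hz]; apply: le_trans (hc _ _ hz) _.
  by apply: ler_wpM2l; [exact: ltW|rewrite lerD2l].
- by move=> z xi w eta [_ hz] [_ [hw _]]; exact: (subdiff_fine _ _ _ _ phiN hz hw).
- by exists (X s), xis; split=> //; apply: hrho => //; exact: le_trans tT.
have hS r xi : s <= r -> r <= t -> subdiff phi (X r) xi -> S (X r) xi.
  by move=> sr rt h; split=> //; apply: hrho; [exact: le_trans sr|exact: le_trans tT].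
rewrite -(PhiE _ _ (hS _ _ st (lexx t) ht)) -(PhiE _ _ (hS _ _ (lexx s) st hs)).
have C0 : 0 <= c * (1 + rho) by rewrite mulr_ge0 ?addr_ge0 // ltW.
apply: (@upper_ac_decreasing R (Phi \o X)) => //.
  apply: (upper_ac_dominated _ _ _ _ _ C0
    (absolutely_continuous_on_sub _ _ _ _ _ s0 tT hac)) => p q _ pq _ /=.
  by apply: le_trans (PhiL _ _) _; rewrite ler_wpM2l // lerDr subr_ge0.
apply: filterS hae => r hr; rewrite in_itv /= => /andP[sr rt].
have [|dX [xi hxi hflow]] := hr.
  by rewrite in_itv /= (le_trans s0 sr) (le_trans rt tT).
(* As [xi] supports [Phi] at [X r], the function <xi, X q> dominates the left increments of
   [Phi \o X]; its derivative at [r] is - |A X'|^2 / alpha. *)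
exists (fun q => dot xi (X q)), (dot 0 (X r) + dot xi ('D_1 X r)); split.
- apply: is_derive_dot; first exact: coord_derive_cst.
  exact: derivable_coord_derive.
- have -> : xi = - (alpha^-1 *: (A^T *m A *m 'D_1 X r)) by rewrite hflow opprK.
  rewrite dotC dot0r add0r dotNl dotZl dot_gram oppr_le0 mulr_ge0 ?dot_ge0 //.
  by rewrite invr_ge0 ltW.
- move=> q sq qr /=; have := Phisub _ _ (X q) (hS _ _ sr rt hxi).
  by rewrite dotBr; lra.
Qed.

Lemma solution_value_bound {R : realType} {m n : nat} (A : 'M[R]_(m, n))
    (phi : 'cV[R]_n -> \bar R) (alpha T : R) (x0 z : 'cV[R]_n) (X : R -> 'cV[R]_n)
    (t : R) (xi : 'cV[R]_n) :
  (forall y, phi y != -oo%E) -> assumption_S2 phi -> 0 < alpha ->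
  solution A phi alpha T x0 X -> dom phi z ->
  0 < t -> t <= T -> subdiff phi (X t) xi ->
  fine (phi (X t)) - fine (phi z) <=
    sigma_max A ^+ 2 * enorm (x0 - z) ^+ 2 / (2 * alpha * t).
Proof.
move=> phiN hS2 a0 hX hz t0 tT hxi; have [hac X0 hae] := hX.
have [rho rho0 hrho] := absolutely_continuous_bounded _ _ _
  (le_trans (ltW t0) tT) hac.
pose E s := dot (A *m (X s - z)) (A *m (X s - z)).
have [C C0 hC] : exists2 C, 0 <= C & forall s t, 0 <= s <= T -> 0 <= t <= T ->
    E t - E s <= C * enorm (X t - X s) by exact: energy_lipschitz hrho.
(* [v] is frozen at the final time [t], so [phi] is never differentiated along [X]. *)
set v := fine (phi (X t)) - fine (phi z).
have a2 : 0 < 2 * alpha by rewrite mulr_gt0.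
have : E t + 2 * alpha * v * t <= E 0 + 2 * alpha * v * 0.
  apply: (@upper_ac_decreasing R (fun s => E s + 2 * alpha * v * s)) => //.
  - exact: ltW.
  - have C'0 : 0 <= C + `|2 * alpha * v| by rewrite addr_ge0.
    apply: (upper_ac_dominated _ _ _ _ _ C'0
      (absolutely_continuous_on_sub _ _ _ _ _ (lexx 0) tT hac)) => p q p0 pq qt.
    have := hC p q; rewrite p0 (le_trans pq (le_trans qt tT)).
    rewrite (le_trans p0 pq) (le_trans qt tT) => /(_ isT isT).
    have pq0 : 0 <= q - p by rewrite subr_ge0.
    have := ler_wpM2r pq0 (ler_norm (2 * alpha * v)).
    have := mulr_ge0 C0 pq0.
    have := mulr_ge0 (normr_ge0 (2 * alpha * v)) (enorm_ge0 (X q - X p)).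
    by lra.
  - apply: filterS hae => r hr; rewrite in_itv /= => /andP[r0 rt].
    have [|dX [eta heta hflow]] := hr.
      by rewrite in_itv /= r0 (le_trans rt tT).
    exists (fun s => E s + 2 * alpha * v * s),
      (- (2 * alpha * dot eta (X r - z)) + 2 * alpha * v); split=> //.
    + apply: is_deriveD; first exact: energy_derive.
      have := is_deriveZ (2 * alpha * v) (is_derive_id r 1).
      by move=> /is_derive_eq; apply; rewrite /= [_ *: _]mulr1.
    + have := solution_value_decreasing _ _ _ _ _ _ _ _ _ _ phiN hS2 a0 hX r0 rt tT
        heta hxi.
      have := subdiff_fine _ _ _ _ phiN heta hz; rewrite -(opprB (X r)) dotNr.
      move=> h1 h2; rewrite addrC -mulrBr pmulr_rle0 // /v; lra.
rewrite mulr0 addr0 => hE.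
rewrite ler_pdivlMr ?mulr_gt0 // mulrC enorm_sqr.
have := sigma_max_bound A (x0 - z); rewrite -X0 -/(E 0).
by have := dot_ge0 (A *m (X t - z)); rewrite -/(E t); lra.
Qed.

Lemma solution_contraction {R : realType} {m n : nat} (A : 'M[R]_(m, n))
    (phi : 'cV[R]_n -> \bar R) (alpha T mu : R) (x0 z : 'cV[R]_n)
    (X : R -> 'cV[R]_n) (t : R) :
  (forall y, phi y != -oo%E) -> 0 < alpha -> strongly_convex mu phi ->
  solution A phi alpha T x0 X -> subdiff phi z 0 -> 0 < sigma_max A ^+ 2 ->
  0 <= t -> t <= T ->
  dot (A *m (X t - z)) (A *m (X t - z)) <=
    sigma_max A ^+ 2 * enorm (x0 - z) ^+ 2 *
    expR (- (mu * alpha * t / sigma_max A ^+ 2)).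
Proof.
move=> phiN a0 hsc [hac X0 hae] hz sig0 t0 tT; have mu0 := hsc.1.
have [rho rho0 hrho] := absolutely_continuous_bounded _ _ _ (le_trans t0 tT) hac.
pose E s := dot (A *m (X s - z)) (A *m (X s - z)).
have [C C0 hC] : exists2 C, 0 <= C & forall s t, 0 <= s <= T -> 0 <= t <= T ->
    E t - E s <= C * enorm (X t - X s) by exact: energy_lipschitz hrho.
have [B B0 hB] : exists2 B, 0 <= B & forall t, 0 <= t <= T -> E t <= B.
  exact: energy_bounded hrho.
rewrite -/(E t).
set sig := sigma_max A ^+ 2 in sig0 *.
pose l := mu * alpha / sig.
have l0 : 0 < l := divr_gt0 (mulr_gt0 mu0 a0) sig0.
have : expR (l * t) * E t <= expR (l * 0) * E 0.
  apply: (@upper_ac_decreasing R (fun s => expR (l * s) * E s)) => //.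
  - have M0 : 0 <= expR (l * t) * (C + l * B).
      exact: mulr_ge0 (expR_ge0 _) (addr_ge0 C0 (mulr_ge0 (ltW l0) B0)).
    apply: (upper_ac_dominated _ _ _ _ _ M0
      (absolutely_continuous_on_sub _ _ _ _ _ (lexx 0) tT hac)) => p q p0 pq qt.
    have pT : 0 <= p <= T by rewrite p0 (le_trans pq (le_trans qt tT)).
    have qT : 0 <= q <= T by rewrite (le_trans p0 pq) (le_trans qt tT).
    have hCpq := hC p q pT qT; have hBp := hB p pT.
    have pq0 : 0 <= q - p by rewrite subr_ge0.
    (* This is 1 + x <= exp x at x = - l (q - p). *)
    have hexp : expR (l * q) - expR (l * p) <= expR (l * q) * (l * (q - p)).
      have -> : expR (l * p) = expR (l * q) * expR (- (l * (q - p))).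
        by rewrite -expRD; congr expR; ring.
      rewrite -{1}[expR (l * q)]mulr1 -mulrBr ler_wpM2l ?expR_ge0 //.
      by have := expR_ge1Dx (- (l * (q - p))); lra.
    have hqt : expR (l * q) <= expR (l * t) by rewrite ler_expR ler_wpM2l // ltW.
    have E0 : 0 <= E p by exact: dot_ge0.
    have lpq : 0 <= l * (q - p) := mulr_ge0 (ltW l0) pq0.
    have -> : expR (l * q) * E q - expR (l * p) * E p =
      expR (l * q) * (E q - E p) + (expR (l * q) - expR (l * p)) * E p by ring.
    apply: (@le_trans _ _ (expR (l * q) * (C * enorm (X q - X p) + l * (q - p) * B))).
      rewrite [leRHS]mulrDr; apply: lerD; first by rewrite ler_wpM2l ?expR_ge0.
      apply: le_trans (ler_wpM2r E0 hexp) _.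
      by rewrite -[leLHS]mulrA ler_wpM2l ?expR_ge0 // ler_wpM2l ?hBp.
    rewrite -[leRHS]mulrA; apply: ler_pM => //.
      exact: addr_ge0 (mulr_ge0 C0 (enorm_ge0 _)) (mulr_ge0 lpq B0).
    have := mulr_ge0 C0 pq0.
    by have := mulr_ge0 (mulr_ge0 (ltW l0) B0) (enorm_ge0 (X q - X p)); lra.
  - apply: filterS hae => r hr; rewrite in_itv /= => /andP[r0 rt].
    have [|dX [eta heta hflow]] := hr.
      by rewrite in_itv /= r0 (le_trans rt tT).
    exists (fun s => expR (l * s) * E s),
      (expR (l * r) * - (2 * alpha * dot eta (X r - z)) + E r * (expR (l * r) * l)).
    split=> //.
    + have hE := energy_derive A alpha X z eta r a0 dX hflow.
      have hl : is_derive r 1 (fun s => l * s) l.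
        have := is_deriveZ l (is_derive_id r 1).
        by move=> /is_derive_eq; apply; rewrite /= [_ *: _]mulr1.
      have he := is_derive1_comp (is_derive_expR (l * r)) hl.
      have := is_deriveM he hE.
      by move=> /is_derive_eq; apply.
    (* Strong convexity is used twice, from [X r] with [eta] and from [z] with subgradient 0; the
       two halves [mu / 2] add up to [mu]. *)
    + have h1 := strongly_convex_fine _ _ _ _ _ phiN hsc heta hz.1.
      have h2 := strongly_convex_fine _ _ _ _ _ phiN hsc hz heta.1.
      have h3 : E r <= sig * enorm (X r - z) ^+ 2.
        by rewrite enorm_sqr; exact: sigma_max_bound.
      move: h1 h2; rewrite -(opprB (X r)) enormN dotNr [dot 0 _]dotC dot0r => h1 h2.
      have h4 : l * E r <= alpha * dot eta (X r - z).
        apply: le_trans (ler_wpM2l (ltW l0) h3) _.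
        rewrite /l mulrA divfK ?gt_eqF // [mu * alpha]mulrC -mulrA.
        by apply: ler_wpM2l; [exact: ltW|lra].
      (* By [h4] the derivative is at most [- (l * E r)] times the weight, so this sign
         concludes. *)
      have h5 : 0 <= l * E r := mulr_ge0 (ltW l0) (dot_ge0 _).
      rewrite [E r * _]mulrCA -mulrDr pmulr_rle0 ?expR_gt0 //.
      by lra.
rewrite mulr0 expR0 mul1r => hE.
have -> : mu * alpha * t / sig = l * t by rewrite /l; ring.
rewrite expRN ler_pdivlMr ?expR_gt0 // mulrC; apply: le_trans hE _.
by rewrite /E X0 enorm_sqr; exact: sigma_max_bound.
Qed.

Theorem proposition12 (R : realType) (m n : nat)
    (f : 'cV[R]_n -> \bar R) (g : 'cV[R]_m -> \bar R) (A : 'M[R]_(m, n))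
    (hS1 : assumption_S1 f g A) (hS2 : assumption_S2 (composite f g A))
    (xstar : 'cV[R]_n) (hxstar : minimizer (composite f g A) xstar)
    (alpha : R) (halpha : 0 < alpha) (T : R) (hT : 0 <= T)
    (x0 : 'cV[R]_n) (hx0 : dom (composite f g A) x0)
    (X : R -> 'cV[R]_n) (hX : solution A (composite f g A) alpha T x0 X) :
  (convexf (composite f g A) ->
    {ae (@lebesgue_measure R), forall t, t \in `[0, T] ->
      (composite f g A (X t) - ereal_inf (range (composite f g A)) <=
       (sigma_max A ^+ 2 * enorm (x0 - xstar) ^+ 2 / (2 * alpha * t))%:E)%E})
  /\
  (forall mu : R, strongly_convex mu (composite f g A) ->
    {ae (@lebesgue_measure R), forall t, t \in `[0, T] ->
      enorm (X t - xstar) ^+ 2 <=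
        cond_num A ^+ 2 * enorm (x0 - xstar) ^+ 2 *
        expR (- (mu * alpha * t / sigma_max A ^+ 2))}).
Proof.
have [[fN _] _ _ _] := S1_f hS1; have [[gN _] _ _ _] := S1_g hS1.
set phi := composite f g A in hS2 hxstar hx0 hX *.
have phiN y : phi y != -oo%E by rewrite /phi /composite adde_eq_ninfty negb_or fN gN.
(* [xstar] shares its value with the minimizer from [S1_min], where the value is finite. *)
have phistar : phi xstar \is a fin_num.
  have [x [xfin xmin]] := S1_min hS1.
  by rewrite (_ : phi xstar = phi x) //; apply/eqP; rewrite eq_le hxstar xmin.
have phiinf : ereal_inf (range phi) = phi xstar.
  apply/eqP; rewrite eq_le; apply/andP; split.
    by apply: ereal_inf_lbound; exists xstar.
  by apply: le_ereal_inf_tmp => _ [y _ <-].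
have hstar := minimizer_subdiff _ _ phistar hxstar.
split=> [_|mu hmu].
  (* Time 0 is discarded: there division by zero gives 0, and the bound would force [x0] to be a
     minimizer already. *)
  have hae0 : {ae @lebesgue_measure R, forall t : R, t != 0}.
    exists [set 0]; split; [exact: measurable_set1|exact: lebesgue_measure_set1|].
    by move=> t /= /negP; rewrite negbK => /eqP.
  have [_ _ hae] := hX.
  apply: filterS2 hae hae0 => t ht tn0 tT.
  have [_ [xi hxi _]] := ht tT.
  move: tT; rewrite in_itv /= => /andP[t0 tT].
  have tgt0 : 0 < t by rewrite lt_neqAle eq_sym tn0.
  have Xfin : phi (X t) \is a fin_num by rewrite fin_numE phiN lt_eqF //; exact: hxi.1.
  have := solution_value_bound _ _ _ _ _ _ _ _ _ phiN hS2 halpha hX hstar.1 tgt0 tT hxi.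
  by rewrite phiinf -(fineK Xfin) -(fineK phistar) -EFinB lee_fin.
(* Here the estimate holds at every time of the interval. *)
apply: filterE => t; rewrite in_itv /= => /andP[t0 tT].
(* For [n = 0] there are no singular values, but all vectors coincide. *)
have [n0|n0] := posnP n.
  have -> : X t - xstar = 0 by clear -n0; subst n; exact: flatmx0.
  rewrite enorm_sqr dot0r.
  exact: mulr_ge0 (mulr_ge0 (sqr_ge0 _) (sqr_ge0 _)) (expR_ge0 _).
have [smin0 hsmin] := sigma_min_bound A n0 (S1_rank hS1).
have smin2 : 0 < sigma_min A ^+ 2 by rewrite exprn_gt0.
have smax2 : 0 < sigma_max A ^+ 2.
  (* Any nonzero vector shows that [sigma_max A ^+ 2] is at least [sigma_min A ^+ 2]. *)
  pose e : 'cV[R]_n := const_mx 1.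
  have e0 : e != 0.
    apply/eqP => /matrixP /(_ (Ordinal n0) 0).
    by rewrite !mxE => /eqP; rewrite oner_eq0.
  rewrite -(pmulr_lgt0 _ (dot_gt0 _ e0)); apply: lt_le_trans (sigma_max_bound A e).
  by apply: lt_le_trans (hsmin e); rewrite mulr_gt0 // dot_gt0.
have := solution_contraction _ _ _ _ _ _ _ _ _ phiN halpha hmu hX hstar smax2 t0 tT.
move=> /(le_trans (hsmin _)); rewrite -enorm_sqr => h.
rewrite /cond_num expr_div_n -(ler_pM2l smin2); apply: le_trans h _.
by rewrite le_eqVlt; apply/orP; left; apply/eqP; field; rewrite gt_eqF.
Qed.
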